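(* Let $R$ be a commutative noetherian ring. Let $\mathcal{A}$ be a class of $R$-modules closed under isomorphisms and let $A$ be a complex of $R$-modules with $A_i\in \mathcal{A}$ for every $i\in\mathbb{Z}$ and differentials $\partial_i:A_i\to A_{i-1}$. Suppose at least one of the following holds: (1) the canonical surjection $A_i\twoheadrightarrow \operatorname{coker}(\partial_{i+1})$ is an $\mathcal{A}$-cover for all $i\in \mathbb{Z}$; or (2) the canonical injection $\ker(\partial_i)\hookrightarrow A_i$ is an $\mathcal{A}$-envelope for all $i\in \mathbb{Z}$. Then $A$ is a minimal complex.
   Context: A morphism $\phi:F\to M$ with $F\in\mathcal{A}$ is an $\mathcal{A}$-cover of the $R$-module $M$ if (i) for every map $\phi':F'\to M$ with $F'\in\mathcal{A}$ there exists $f:F'\to F$ with $\phi f=\phi'$, and (ii) every endomorphism $f:F\to F$ with $\phi f=\phi$ is an isomorphism. A morphism $\phi:M\to F$ with $F\in\mathcal{A}$ is an $\mathcal{A}$-envelope of $M$ if (i) for every map $\phi':M\to F'$ with $F'\in\mathcal{A}$ there exists $f:F\to F'$ with $f\phi=\phi'$, and (ii) every endomorphism $f:F\to F$ with $f\phi=\phi$ is an isomorphism. Complexes may be unbounded. A complex $C$ is minimal if every homotopy equivalence $\gamma:C\to C$ (degree zero chain map) is an isomorphism of complexes. The paper assumes throughout that $R$ is commutative and noetherian. *)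

(* Defs.v *)
From HB Require Import structures.
From mathcomp Require Import all_boot all_order all_algebra.
From mathcomp Require Import boolp.

Set Implicit Arguments.
Unset Strict Implicit.
Unset Printing Implicit Defensive.

Import GRing.Theory.
Local Open Scope ring_scope.
Local Open Scope quotient_scope.

(* Ideals of R are the submodules of the regular module R^o.  (The library's
   [idealr] denotes proper ideals only, hence is not used here.)
   [comPzRingType] allows the zero ring. *)
Definition noetherian (R : comPzRingType) : Prop :=
  forall I : {pred R^o}, submod_closed I ->
  exists (n : nat) (g : 'I_n -> R^o),
    forall x : R^o, x \in I <-> exists c : 'I_n -> R, x = \sum_(i < n) c i *: g i.

Section QuotientModule.
Variables (R : pzRingType) (V : lmodType R) (S : submodClosed V).

(* The library does not derive [zmodClosed] from [submodClosed]. *)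
Definition submod_pred : {pred V} := S.

Lemma submod_zmod_closed : zmod_closed submod_pred.
Proof. exact: GRing.submod_closedB (submodClosedP S). Qed.
HB.instance Definition _ :=
  GRing.isZmodClosed.Build V submod_pred submod_zmod_closed.

Definition quotmod : Type := Quotient.quot submod_pred.
HB.instance Definition _ := GRing.Zmodule.on quotmod.

Definition quotmod_pi (x : V) : quotmod := \pi_(Quotient.quot submod_pred) x.

Definition quotmod_scale (a : R) (u : quotmod) : quotmod :=
  quotmod_pi (a *: repr (u : Quotient.quot submod_pred)).

Lemma quotmod_pi_eq x y : quotmod_pi x = quotmod_pi y <-> x - y \in S.
Proof.
have := Quotient.idealrBE submod_pred x y.
rewrite -[x - y \in submod_pred]/(x - y \in S) => ->.
by split=> [xy|/eqP //]; apply/eqP.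
Qed.

Lemma quotmod_reprK (u : quotmod) :
  quotmod_pi (repr (u : Quotient.quot submod_pred)) = u.
Proof. exact: reprK. Qed.

Lemma quotmod_pi_is_zmod_morphism : zmod_morphism quotmod_pi.
Proof. by move=> x y; rewrite /quotmod_pi raddfB. Qed.
HB.instance Definition _ :=
  GRing.isZmodMorphism.Build V quotmod quotmod_pi quotmod_pi_is_zmod_morphism.

Lemma quotmod_piZ a x : quotmod_pi (a *: x) = quotmod_scale a (quotmod_pi x).
Proof.
apply/quotmod_pi_eq; rewrite -scalerBr rpredZ //.
by apply/quotmod_pi_eq; rewrite quotmod_reprK.
Qed.

Lemma quotmod_scalerA a b (u : quotmod) :
  quotmod_scale a (quotmod_scale b u) = quotmod_scale (a * b) u.
Proof. by rewrite -[u]quotmod_reprK -!quotmod_piZ scalerA. Qed.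

Lemma quotmod_scale1r : left_id 1 quotmod_scale.
Proof. by move=> u; rewrite -[u]quotmod_reprK -quotmod_piZ scale1r. Qed.

Lemma quotmod_scalerDr : right_distributive quotmod_scale +%R.
Proof.
move=> a u v; rewrite -[u]quotmod_reprK -[v]quotmod_reprK.
by rewrite -raddfD -!quotmod_piZ scalerDr raddfD.
Qed.

Lemma quotmod_scalerDl (u : quotmod) :
  {morph quotmod_scale^~ u : a b / a + b}.
Proof.
move=> a b; rewrite -[u]quotmod_reprK.
by rewrite -!quotmod_piZ scalerDl raddfD.
Qed.

HB.instance Definition _ := GRing.Zmodule_isLmodule.Build R quotmod
  quotmod_scalerA quotmod_scale1r quotmod_scalerDr quotmod_scalerDl.

Lemma quotmod_pi_is_scalable : scalable quotmod_pi.
Proof. by move=> a x; rewrite quotmod_piZ. Qed.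
HB.instance Definition _ :=
  GRing.isScalable.Build R V quotmod *:%R quotmod_pi quotmod_pi_is_scalable.

End QuotientModule.

Section KernelCokernel.
Variables (R : pzRingType) (U V : lmodType R) (f : {linear U -> V}).

Definition ker_pred : {pred U} := [pred x | f x == 0].

Lemma ker_submod_closed : submod_closed ker_pred.
Proof.
split=> [|a x y]; rewrite !inE ?linear0 // => /eqP fx /eqP fy.
by rewrite linearP fx fy scaler0 addr0.
Qed.
HB.instance Definition _ :=
  GRing.isSubmodClosed.Build R U ker_pred ker_submod_closed.

Definition kernel : Type := {x : U | x \in ker_pred}.
HB.instance Definition _ := SubChoice.on kernel.
HB.instance Definition _ := [SubChoice_isSubLmodule of kernel by <:].

Definition ker_incl : {linear kernel -> U} := \val.

Definition im_pred : {pred V} := [pred y | `[< exists x, f x = y >]].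

Lemma im_submod_closed : submod_closed im_pred.
Proof.
split=> [|a _ _ /asboolP[x <-] /asboolP[y <-]]; apply/asboolP.
  by exists 0; rewrite linear0.
by exists (a *: x + y); rewrite linearP.
Qed.
HB.instance Definition _ :=
  GRing.isSubmodClosed.Build R V im_pred im_submod_closed.

Definition cokernel : lmodType R := quotmod im_pred.

Definition coker_proj : {linear V -> cokernel} := @quotmod_pi R V im_pred.

End KernelCokernel.

Definition lin_iso (R : pzRingType) (M N : lmodType R) (f : {linear M -> N}) :
    Prop :=
  exists g : {linear N -> M}, cancel f g /\ cancel g f.

Definition iso_closed (R : pzRingType) (AA : lmodType R -> Prop) : Prop :=
  forall (M N : lmodType R) (f : {linear M -> N}), lin_iso f -> AA M -> AA N.

Definition is_cover (R : pzRingType) (AA : lmodType R -> Prop)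
    (F M : lmodType R) (phi : {linear F -> M}) : Prop :=
  [/\ AA F,
      forall (F' : lmodType R) (phi' : {linear F' -> M}), AA F' ->
        exists f : {linear F' -> F}, phi \o f =1 phi'
    & forall f : {linear F -> F}, phi \o f =1 phi -> lin_iso f].

Definition is_envelope (R : pzRingType) (AA : lmodType R -> Prop)
    (M F : lmodType R) (phi : {linear M -> F}) : Prop :=
  [/\ AA F,
      forall (F' : lmodType R) (phi' : {linear M -> F'}), AA F' ->
        exists f : {linear F -> F'}, f \o phi =1 phi'
    & forall f : {linear F -> F}, f \o phi =1 phi -> lin_iso f].

(* The differential is a family indexed by all pairs (i, j), zero unless
   j = i - 1, so that d_i = diff i (i - 1) and d_(i+1) = diff (i + 1) i are
   composable without transport along (i + 1) - 1 = i. *)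
Record complex (R : pzRingType) := Complex {
  cmod :> int -> lmodType R;
  diff : forall i j : int, {linear cmod i -> cmod j};
  diff_shape : forall i j : int, j != i - 1 -> forall x, diff i j x = 0;
  diff_diff : forall (i j k : int) x, diff j k (diff i j x) = 0
}.

Record chain_map (R : pzRingType) (C D : complex R) := ChainMap {
  cmap :> forall i : int, {linear C i -> D i};
  cmap_diff : forall (i j : int) x,
    cmap j (diff C i j x) = diff D i j (cmap i x)
}.

Program Definition chain_id (R : pzRingType) (C : complex R) :
    chain_map C C :=
  @ChainMap R C C (fun i => idfun) _.

Program Definition chain_comp (R : pzRingType) (C D E : complex R)
    (g : chain_map D E) (f : chain_map C D) : chain_map C E :=
  @ChainMap R C E (fun i => g i \o f i) _.
Next Obligation. by rewrite /= !cmap_diff. Qed.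

(* Only the components s i (i + 1) : C_i -> D_(i+1) of s are used. *)
Definition homotopic (R : pzRingType) (C D : complex R) (f g : chain_map C D) :
    Prop :=
  exists s : forall i j : int, {linear C i -> D j},
  forall (i : int) (x : C i),
    f i x - g i x =
      diff D (i + 1) i (s i (i + 1) x) + s (i - 1) i (diff C i (i - 1) x).

Definition homotopy_equivalence (R : pzRingType) (C D : complex R)
    (f : chain_map C D) : Prop :=
  exists g : chain_map D C,
    homotopic (chain_comp g f) (chain_id C) /\
    homotopic (chain_comp f g) (chain_id D).

Definition chain_iso (R : pzRingType) (C D : complex R) (f : chain_map C D) :
    Prop :=
  exists g : chain_map D C,
    forall i : int, cancel (f i) (g i) /\ cancel (g i) (f i).

Definition minimal_complex (R : pzRingType) (C : complex R) : Prop :=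
  forall f : chain_map C C, homotopy_equivalence f -> chain_iso f.

(* Main.v *)
Require Import Defs.
From mathcomp Require Import all_boot all_order all_algebra.
From mathcomp Require Import boolp.

Set Implicit Arguments.
Unset Strict Implicit.
Unset Printing Implicit Defensive.

Import GRing.Theory.
Local Open Scope ring_scope.

(** If [gamma] is a homotopy equivalence with homotopy inverse [g], then both
    composites of [gamma] and [g] are homotopic to the identity; if these
    composites are isomorphisms, then so is [gamma].  So it is enough to show
    that every chain map [e = 1 + d s + s d] is an isomorphism in each degree.
    Since [d d = 0], it factors as [e = (1 + s d) (1 + d s)] (the opposite order
    would leave a term [d s s d]), and it remains to invert the two factors.

    The cover hypothesis inverts [1 + d s], since composing it with the
    projection onto [coker d] gives back that projection; dually, the envelope
    hypothesis inverts [1 + s d], since it restricts to the identity on [ker d].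
    In either case the other factor follows from the classical fact that
    [1 + a b] is invertible if and only if [1 + b a] is
    ([lin_iso_id_add_comp]), applied to [d : A_i -> A_(i-1)] and
    [s : A_(i-1) -> A_i]. *)

Lemma eq_lin_iso (R : pzRingType) (M N : lmodType R) (f g : {linear M -> N}) :
  f =1 g -> lin_iso f -> lin_iso g.
Proof.
move=> fg [h [fK hK]]; exists h; split=> x; first by rewrite -fg fK.
by rewrite -fg hK.
Qed.

Lemma lin_iso_comp (R : pzRingType) (M N P : lmodType R)
    (g : {linear N -> P}) (f : {linear M -> N}) :
  lin_iso g -> lin_iso f -> lin_iso (g \o f).
Proof.
move=> [g' [gK g'K]] [f' [fK f'K]]; exists (f' \o g').
by split; apply: can_comp.
Qed.

(** The inverse of [1 + a b] is [1 - a (1 + b a)^-1 b], as one guesses by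
    expanding both inverses as geometric series. *)
Lemma lin_iso_id_add_comp (R : pzRingType) (M N : lmodType R)
    (a : {linear N -> M}) (b : {linear M -> N}) :
  lin_iso (idfun \+ (b \o a)) -> lin_iso (idfun \+ (a \o b)).
Proof.
move=> [h [hK Kh]]; exists (idfun \- (a \o (h \o b))).
split=> x /=.
  have -> : b (x + a (b x)) = (idfun \+ (b \o a)) (b x) by rewrite /= linearD.
  by rewrite hK addrK.
have -> : b (x - a (h (b x))) = h (b x).
  by rewrite linearB -{1}[b x]Kh /= addrK.
by rewrite subrK.
Qed.

(** A left inverse of [f] is read off from [g f], and [f] is surjective because
    [f g] is. *)
Lemma lin_iso_of_comps (R : pzRingType) (M N : lmodType R)
    (f : {linear M -> N}) (g : {linear N -> M}) :
  lin_iso (g \o f) -> lin_iso (f \o g) -> lin_iso f.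
Proof.
move=> [h [hK _]] [k [_ Kk]]; exists (h \o g); split=> [x|y]; first exact: hK.
by rewrite -[y]Kk /=; congr (f _); apply: hK.
Qed.

Lemma chain_iso_of_lin_iso (R : pzRingType) (C D : complex R)
    (f : chain_map C D) :
  (forall i, lin_iso (f i)) -> chain_iso f.
Proof.
move=> f_iso.
pose g i := projT1 (cid (f_iso i)).
have gP i : cancel (f i) (g i) /\ cancel (g i) (f i) := projT2 (cid (f_iso i)).
have g_diff i j x : g j (diff D i j x) = diff C i j (g i x).
  by rewrite -[in LHS](proj2 (gP i) x) -cmap_diff (proj1 (gP j)).
by exists (ChainMap g_diff).
Qed.

(** Assuming an equation [j = i + 1], rather than writing [i + 1] for [j], makes
    the hypothesis apply to both terms of a homotopy: the second one involves a
    map from degree [n - 1] to degree [n], and [A n] is not convertible to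
    [A (n - 1 + 1)]. *)
Lemma minimal_complex_of_lin_iso (R : pzRingType) (A : complex R) :
  (forall (i j : int) (s : {linear A i -> A j}), j = i + 1 ->
     lin_iso (idfun \+ (diff A j i \o s))) ->
  minimal_complex A.
Proof.
move=> ds_iso.
have homotopic_id_iso (e : chain_map A A) :
  homotopic e (chain_id A) -> forall i, lin_iso (e i).
  move=> [s e_s] i.
  have sd_iso : lin_iso (idfun \+ (s (i - 1) i \o diff A i (i - 1))).
    by apply: lin_iso_id_add_comp; apply: ds_iso; rewrite subrK.
  apply: eq_lin_iso (lin_iso_comp sd_iso (ds_iso _ _ (s i (i + 1)) erefl)).
  move=> x /=; have := e_s i x; rewrite /= => /eqP; rewrite subr_eq => /eqP->.
  by rewrite linearD diff_diff addr0 -addrA addrC.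
move=> f [g [gf_id fg_id]]; apply: chain_iso_of_lin_iso => i.
apply: (@lin_iso_of_comps _ _ _ _ (g i)).
  exact: (homotopic_id_iso _ gf_id i).
exact: (homotopic_id_iso _ fg_id i).
Qed.

Theorem theorem4p1 (R : comPzRingType) (R_noetherian : noetherian R)
    (AA : lmodType R -> Prop) (AA_iso : iso_closed AA)
    (A : complex R) (A_AA : forall i : int, AA (A i)) :
  (forall i : int, is_cover AA (coker_proj (diff A (i + 1) i))) \/
  (forall i : int, is_envelope AA (ker_incl (diff A i (i - 1)))) ->
  minimal_complex A.
Proof.
case=> [cover|envelope]; apply: minimal_complex_of_lin_iso => i j s.
  move=> ji; subst j; have [_ _] := cover i; apply=> x /=.
  apply/quotmod_pi_eq; rewrite addrC addKr.
  by apply/asboolP; exists (s x).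
move=> ji; have {ji} ij : i = j - 1 by rewrite ji addrK.
subst i; apply: lin_iso_id_add_comp.
have [_ _] := envelope j; apply=> x /=.
by have /eqP -> := valP x; rewrite linear0 addr0.
Qed.
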